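(* Let $C$ be a bounded convex subset of a Banach space $X$. Fix $\lambda\in(0,1)$ and $\gamma\in[\lambda,1)$, and let $\mathcal{F}$ denote the collection of all mappings $T:C\to C$ which satisfy condition $(C_\lambda)$. For $T\in\mathcal{F}$ let $T_\gamma=(1-\gamma)I+\gamma T$. Then for every $\varepsilon>0$ there exists a positive integer $n_0$ such that $\|T_\gamma^{n+1}x-T_\gamma^{n}x\|<\varepsilon$ for every $n\ge n_0$, every $x\in C$ and every $T\in\mathcal{F}$.
   Context: For $\lambda\in(0,1)$, a mapping $T:C\to X$ defined on a nonempty subset $C$ of a Banach space $X$ satisfies condition $(C_\lambda)$ if for all $x,y\in C$: $\lambda\|x-Tx\|\le\|x-y\|$ implies $\|Tx-Ty\|\le\|x-y\|$. Here $I$ is the identity map and $T_\gamma^n$ is the $n$-th iterate of $T_\gamma:C\to C$. *)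

(* Defs.v *)
From HB Require Import structures.
From mathcomp Require Export all_boot all_order all_algebra.
From mathcomp Require Export all_classical all_reals all_analysis.
Export Order.TTheory GRing.Theory Num.Theory.
Export numFieldNormedType.Exports.

Set Implicit Arguments.
Unset Strict Implicit.
Unset Printing Implicit Defensive.

Local Open Scope classical_set_scope.
Local Open Scope ring_scope.

(* A mapping defined on C is encoded as a total function on X; its values
   outside C are arbitrary and never constrained. *)
Definition condition_C (R : realType) (X : normedModType R) (lambda : R)
    (C : set X) (T : X -> X) : Prop :=
  forall x y : X, C x -> C y ->
    lambda * `|x - T x| <= `|x - y| -> `|T x - T y| <= `|x - y|.

Definition C_self_maps (R : realType) (X : normedModType R) (lambda : R)
    (C : set X) : set (X -> X) :=
  [set T | set_fun C C T /\ condition_C lambda C T].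

Definition averaged (R : realType) (X : normedModType R) (gamma : R)
    (T : X -> X) : X -> X :=
  fun x => (1 - gamma) *: x + gamma *: T x.

(* Main.v *)
Require Import Defs.
From mathcomp Require Import lra.

(** Write [y_k = T x_k] along the orbit [x_(k+1) = (1 - g) x_k + g y_k] of the
averaged map.  Since [g >= lambda], the displacement satisfies
[lambda |x_k - T x_k| <= g |x_k - T x_k| = |x_k - x_(k+1)|], so condition
(C_lambda) applies to each pair of consecutive orbit points and gives
[|y_(k+1) - y_k| <= |x_(k+1) - x_k|].  From there on only the two sequences
matter, not the map ([averaging_pair]).

For such sequences the gaps [d_k = |y_k - x_k|] do not increase, and they obey
the inequality of Goebel and Kirk ([goebel_kirk]); in a form without inverses
it reads, with [q = 1 - g],
  [q^n (1 + n g) d_i <= q^n |y_(i+n) - x_i| + (d_i - d_(i+n))].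
If all [|y_j - x_i|] are at most [D], choose a length [N] with
[(1 + N g) eps >= D + 1].  As long as the gap stays at least [eps], each block
of [N] steps must then lower it by at least [q^N] ([gap_block_drop]).  The gap
starts at most [D], so only boundedly many blocks can do this; the bound on the
number of steps depends on [g], [D] and [eps] alone, which is the uniformity in
the starting point and in the map ([gap_uniformly_small]). *)

Set Implicit Arguments.
Unset Strict Implicit.
Unset Printing Implicit Defensive.

Local Open Scope classical_set_scope.
Local Open Scope ring_scope.

(** An orbit [x] of an averaged map together with its images [y = T \o x], with
the map itself forgotten: a bound proved for all such pairs is uniform in the
map and in the starting point. *)
Definition averaging_pair (R : realType) (X : normedModType R) (g : R)
    (x y : nat -> X) : Prop :=
  forall k, x k.+1 = (1 - g) *: x k + g *: y k
         /\ `|y k.+1 - y k| <= `|x k.+1 - x k|.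

Lemma convex_combination_subl (R : realType) (X : normedModType R) (g : R)
    (a b : X) : (1 - g) *: a + g *: b - a = g *: (b - a).
Proof.
by rewrite scalerBl scale1r scalerBr addrAC [a - _]addrC addrK addrC.
Qed.

Lemma averaging_step (R : realType) (X : normedModType R) (g : R)
    (x y : nat -> X) k :
  0 <= g -> averaging_pair g x y -> `|x k.+1 - x k| = g * `|y k - x k|.
Proof.
move=> g0 /(_ k)[-> _].
by rewrite convex_combination_subl normrZ ger0_norm.
Qed.

(** [y_(k+1) - x_(k+1)] is [y_(k+1) - y_k], of norm at most [g d_k], plus
[(1 - g) (y_k - x_k)]. *)
Lemma gap_step (R : realType) (X : normedModType R) (g : R)
    (x y : nat -> X) k :
  0 <= g <= 1 -> averaging_pair g x y ->
  `|y k.+1 - x k.+1| <= `|y k - x k|.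
Proof.
move=> /andP[g0 g1] xy; have := averaging_step k g0 xy.
case: (xy k) => -> yk stepk.
have -> : y k.+1 - ((1 - g) *: x k + g *: y k)
    = (y k.+1 - y k) + (1 - g) *: (y k - x k).
  rewrite scalerBr [in RHS]scalerBl scale1r opprD.
  by rewrite [in LHS]addrCA [in RHS]addrA [in RHS]addrA subrK addrC.
have := ler_normD (y k.+1 - y k) ((1 - g) *: (y k - x k)).
rewrite normrZ ger0_norm ?subr_ge0//.
move: yk; rewrite stepk; lra.
Qed.

Lemma gap_nonincreasing (R : realType) (X : normedModType R) (g : R)
    (x y : nat -> X) m n :
  0 <= g <= 1 -> averaging_pair g x y -> (m <= n)%N ->
  `|y n - x n| <= `|y m - x m|.
Proof.
move=> g01 xy /subnKC <-; elim: (n - m)%N => [|k IH]; first by rewrite addn0.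
by rewrite addnS; apply: le_trans IH; exact: gap_step g01 xy.
Qed.

(** The increments of [y] are bounded by those of [x], which are [g] times the
gaps, and no later gap exceeds [d_i]. *)
Lemma image_drift (R : realType) (X : normedModType R) (g : R)
    (x y : nat -> X) i n :
  0 <= g <= 1 -> averaging_pair g x y ->
  `|y (i + n)%N - y i| <= n%:R * g * `|y i - x i|.
Proof.
move=> g01 xy; have /andP[g0 _] := g01.
elim: n => [|n IH]; first by rewrite addn0 subrr normr0 !mul0r.
rewrite addnS -(subrKA (y (i + n)%N)); apply: le_trans (ler_normD _ _) _.
rewrite mulrSr !mulrDl mul1r addrC lerD//.
apply: le_trans (xy _).2 _; rewrite (averaging_step _ g0 xy) ler_wpM2l//.
exact: gap_nonincreasing g01 xy (leq_addr _ _).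
Qed.

(** Follows from Bernoulli's inequality [1 + n g <= (1 + g)^n] because
[(1 - g) (1 + g) <= 1]; in [goebel_kirk] it fixes the sign of the coefficient
of the gap difference. *)
Lemma expr_onem_bernoulli (R : realType) (g : R) n :
  0 <= g <= 1 -> (1 - g) ^+ n * (1 + n%:R * g) <= 1.
Proof.
move=> /andP[g0 g1]; elim: n => [|n IH]; first by rewrite expr0 mul0r addr0 mulr1.
apply: le_trans IH; rewrite exprSr -mulrA ler_wpM2l ?exprn_ge0 ?subr_ge0//.
have n0 : 0 <= n%:R * g ^+ 2 :> R by rewrite mulr_ge0 ?exprn_ge0.
rewrite mulrSr; nra.
Qed.

(** Induction on the length [n], applied at [i + 1]: replacing [x_(i+1)] by its
definition costs the term [g |y_(i+n+1) - y_i|], at most [(n + 1) g^2 d_i] by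
the drift bound.  What is then left to check is
[(1 - q^n (1 + n g)) (d_i - d_(i+1)) >= 0], which holds because the gaps do not
increase and [q^n (1 + n g) <= 1]. *)
Lemma goebel_kirk (R : realType) (X : normedModType R) (g : R)
    (x y : nat -> X) i n :
  0 <= g <= 1 -> averaging_pair g x y ->
  (1 - g) ^+ n * (1 + n%:R * g) * `|y i - x i| <=
  (1 - g) ^+ n * `|y (i + n)%N - x i|
    + (`|y i - x i| - `|y (i + n)%N - x (i + n)%N|).
Proof.
move=> g01 xy; have /andP[g0 g1] := g01.
elim: n i => [|n IH] i; first by rewrite addn0 expr0 mul0r subrr !addr0 !mul1r.
have := IH i.+1; rewrite addSnnS.
have := expr_onem_bernoulli n g01.
have := gap_step i g01 xy.
have := image_drift i n.+1 g01 xy.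
have : `|y (i + n.+1)%N - x i.+1| <= (1 - g) * `|y (i + n.+1)%N - x i|
    + g * `|y (i + n.+1)%N - y i|.
  have -> : y (i + n.+1)%N - x i.+1 =
      (1 - g) *: (y (i + n.+1)%N - x i) + g *: (y (i + n.+1)%N - y i).
    by rewrite (xy i).1 !scalerBr addrACA -scalerDl subrK scale1r opprD.
  by apply: le_trans (ler_normD _ _) _; rewrite !normrZ !ger0_norm// subr_ge0.
have : 0 <= (1 - g) ^+ n by rewrite exprn_ge0// subr_ge0.
rewrite exprSr mulrSr.
move: ((1 - g) ^+ n) n%:R => q N.
move: `|y i - x i| `|y i.+1 - x i.+1| => d d'.
move: `|y (i + n.+1)%N - x i| `|y (i + n.+1)%N - x i.+1| => A A'.
move: `|y (i + n.+1)%N - y i| `|y (i + n.+1)%N - x (i + n.+1)%N| => B e.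
move=> q0 hA hB hd hq IHi.
have hA' : q * A' <= q * ((1 - g) * A + g * ((N + 1) * g * d)).
  by apply: ler_wpM2l => //; apply: le_trans hA _; rewrite lerD2l ler_wpM2l.
have hp : 0 <= (1 - q * (1 + N * g)) * (d - d') by rewrite mulr_ge0 ?subr_ge0.
lra.
Qed.

(** The choice of [N] makes the left side of [goebel_kirk] exceed
[q^N |y_(i+N) - x_i|] by at least [q^N], and the gap difference has to make up
for it. *)
Lemma gap_block_drop (R : realType) (X : normedModType R) (g D eps : R)
    (x y : nat -> X) N i :
  0 <= g <= 1 -> averaging_pair g x y ->
  (forall j k, `|y j - x k| <= D) -> D + 1 <= (1 + N%:R * g) * eps ->
  eps <= `|y i - x i| ->
  `|y (i + N)%N - x (i + N)%N| <= `|y i - x i| - (1 - g) ^+ N.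
Proof.
move=> g01 xy hD hN hi; have /andP[g0 g1] := g01.
have q0 : 0 <= (1 - g) ^+ N by rewrite exprn_ge0// subr_ge0.
have hq : (1 - g) ^+ N * (`|y (i + N)%N - x i| + 1) <=
    (1 - g) ^+ N * ((1 + N%:R * g) * `|y i - x i|).
  apply: ler_wpM2l => //; apply: le_trans (_ : D + 1 <= _); first by rewrite lerD2r.
  by apply: le_trans hN _; rewrite ler_wpM2l// addr_ge0 ?mulr_ge0.
have := goebel_kirk i N g01 xy; lra.
Qed.

(** Since [n0] precedes the sequences, it can only count blocks: with [K] chosen
so that [D < K q^N], a gap still at least [eps] after [K] blocks would have
started above [D]. *)
Lemma gap_uniformly_small (R : realType) (X : normedModType R) (g D eps : R) :
  0 < g < 1 -> 0 < eps ->
  exists n0 : nat, forall (x y : nat -> X), averaging_pair g x y ->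
    (forall j k, `|y j - x k| <= D) ->
    forall n, (n0 <= n)%N -> `|y n - x n| < eps.
Proof.
move=> /andP[g0 g1] eps0; have g01 : 0 <= g <= 1 by rewrite !ltW.
have [N hN] : exists N : nat, D + 1 <= (1 + N%:R * g) * eps.
  exists (Num.bound `|(D + 1) / (g * eps)|).
  have := archi_boundP (normr_ge0 ((D + 1) / (g * eps))).
  move/(le_lt_trans (ler_norm _)).
  rewrite ltr_pdivrMr ?mulr_gt0// => /ltW hN.
  by apply: le_trans hN _; rewrite [leRHS]mulrDl mul1r [leLHS]mulrA lerDr ltW.
have q0 : 0 < (1 - g) ^+ N by rewrite exprn_gt0// subr_gt0.
pose K := Num.bound (`|D| / (1 - g) ^+ N).
have hK : D < K%:R * (1 - g) ^+ N.
  rewrite -ltr_pdivrMr//; apply: le_lt_trans (archi_boundP _).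
    by rewrite ler_pM2r ?invr_gt0// ler_norm.
  by rewrite divr_ge0// ltW.
exists (K * N)%N => x y xy hD n hn; rewrite ltNge; apply/negP => hgap.
have drop k : (k <= K)%N ->
    `|y (k * N)%N - x (k * N)%N| <= D - k%:R * (1 - g) ^+ N.
  elim: k => [|k IH] kK; first by rewrite mul0n mul0r subr0.
  have big : eps <= `|y (k * N)%N - x (k * N)%N|.
    apply: le_trans hgap (gap_nonincreasing g01 xy _).
    by apply: leq_trans hn; rewrite leq_mul2r (ltnW kK) orbT.
  have := gap_block_drop g01 xy hD hN big; rewrite mulSnr mulrSr.
  have := IH (ltnW kK); lra.
have := drop K (leqnn K); have := normr_ge0 (y (K * N)%N - x (K * N)%N); lra.
Qed.

Theorem theorem2p1 (R : realType) (X : completeNormedModType R) (C : set X)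
  (hbounded : bounded_set C) (hconvex : convex_set C)
  (lambda gamma : R) (hlambda0 : 0 < lambda) (hlambda1 : lambda < 1)
  (hgammal : lambda <= gamma) (hgamma1 : gamma < 1) :
  forall eps : R, 0 < eps ->
    exists n0 : nat, (0 < n0)%N /\
      forall n : nat, (n0 <= n)%N ->
      forall x : X, C x ->
      forall T : X -> X, C_self_maps lambda C T ->
        `|iter n.+1 (averaged gamma T) x - iter n (averaged gamma T) x| < eps.
Proof.
move=> eps eps0.
have gamma0 : 0 < gamma := lt_le_trans hlambda0 hgammal.
have [M hM] : exists M : R, forall z, C z -> `|z| <= M.
  have [M [_ hM]] := hbounded; exists (M + 1) => z Cz.
  by apply: (hM (M + 1)) => //; rewrite ltrDl.
have [n0 hn0] := @gap_uniformly_small R X gamma (M + M) eps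
  (introT andP (conj gamma0 hgamma1)) eps0.
exists n0.+1; split=> // n /ltnW hn x Cx T [TC condT].
pose u k := iter k (averaged gamma T) x.
have Cu k : C (u k).
  elim: k => [//|k IH]; rewrite /u iterS -/(u k) /averaged.
  pose t := Itv01 (ltW gamma0) (ltW hgamma1).
  have := hconvex _ _ t (mem_set (TC _ IH)) (mem_set IH).
  by rewrite inE /= addrC.
have uT : averaging_pair gamma u (T \o u).
  move=> k; have uS : u k.+1 = (1 - gamma) *: u k + gamma *: T (u k) by [].
  split; first exact: uS.
  rewrite /comp distrC [leRHS]distrC; apply: condT => //.
  rewrite uS [leRHS]distrC convex_combination_subl normrZ gtr0_norm//.
  by rewrite distrC ler_wpM2r.
rewrite (averaging_step n (ltW gamma0) uT).
apply: le_lt_trans (hn0 _ _ uT _ n hn).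
  by rewrite ler_piMl// ltW.
move=> j k /=; apply: le_trans (ler_normB _ _) _.
by apply: lerD; apply: hM => //; apply: TC.
Qed.
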